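(* Let $\mathcal A$ be a central hyperplane arrangement with base region $B$. If $\mathcal A=I_1\cup I_2\cup\cdots\cup I_k$ is a partition of $\mathcal A$ such that each $I_j$ induces an acyclic sub-digraph of the basic digraph $\mathcal D(\mathcal A,B)$, then the order dimension of the poset of regions $\mathcal P(\mathcal A,B)$ is at most $k$. That is, the order dimension of $\mathcal P(\mathcal A,B)$ is bounded above by the size of any covering of $\mathcal D(\mathcal A,B)$ by acyclic induced sub-digraphs.
   Context: A (central) arrangement $\mathcal A$ is a finite, nonempty collection of codimension-1 linear subspaces (hyperplanes) of $\mathbb R^n$. Its regions are the closures of the connected components of $\mathbb R^n\setminus\bigcup_{H\in\mathcal A}H$. Fix a region $B$, the base region. For a region $R$, the separating set $S(R)$ is the set of hyperplanes of $\mathcal A$ separating $R$ from $B$. The poset of regions $\mathcal P(\mathcal A,B)$ is the set of regions with $R_1\le R_2$ if and only if $S(R_1)\subseteq S(R_2)$. A subset $\mathcal A'\subseteq\mathcal A$ is a rank-two subarrangement if $|\mathcal A'|>1$ and there is a codimension-two linear subspace $L$ such that $\mathcal A'$ is the set of all hyperplanes of $\mathcal A$ containing $L$. Let $B'$ be the unique region of $\mathcal A'$ containing $B$; the (two) hyperplanes of $\mathcal A'$ bounding $B'$ are called basic in $\mathcal A'$. The basic digraph $\mathcal D(\mathcal A,B)$ has vertex set $\mathcal A$ and, for distinct $H_1,H_2\in\mathcal A$, a directed edge $H_1\to H_2$ whenever $H_1$ is basic in the rank-two subarrangement determined by $H_1\cap H_2$ (i.e. the set of all hyperplanes of $\mathcal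 A$ containing $H_1\cap H_2$). Acyclic means having no directed cycles; two oppositely directed edges between the same two vertices form a directed cycle. The order dimension of a finite poset $P$ is the smallest $d$ such that $P$ embeds as an induced subposet of $\mathbb R^d$ with the componentwise order. *)

(* Defs.v *)
From mathcomp Require Import all_boot all_order all_algebra finmap.
From mathcomp Require Import all_classical all_reals topology normedtype.
Set Implicit Arguments.
Unset Strict Implicit.
Unset Printing Implicit Defensive.
Import Order.TTheory GRing.Theory Num.Theory.
Import numFieldNormedType.Exports.
Local Open Scope classical_set_scope.
Local Open Scope ring_scope.

Section Arrangements.
Variables (R : realType) (n : nat).
Local Notation V := 'rV[R]_n.
Implicit Types (A : {fset {vspace V}}) (B X Y : set V) (H L : {vspace V}).

Definition hyperplane H := (\dim H).+1 == n.

Definition is_arrangement A :=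
  A != fset0 /\ (forall H, H \in A -> hyperplane H).

Definition complement A : set V := [set x | forall H, H \in A -> x \notin H].

Definition is_region A X :=
  exists2 x, complement A x
           & X = closure (connected_component (complement A) x).

(* Regions are closed with nonempty interior, so lying in opposite closed
   half-spaces bounded by H is the same as being separated by H; in particular
   no hyperplane separates a region from itself. *)
Definition separates H X Y :=
  exists f : 'Hom(V, R^o), [/\ lker f = H,
    (forall x, X x -> 0 <= f x) & (forall y, Y y -> f y <= 0)].

Definition separating_set A B X : set {vspace V} :=
  [set H | H \in A /\ separates H X B].

Definition region A := {X : set V | is_region A X}.

Definition region_le A B (X Y : region A) : Prop :=
  separating_set A B (sval X) `<=` separating_set A B (sval Y).

Definition subarrangement A L : {fset {vspace V}} :=
  [fset H in A | (L <= H)%VS]%fset.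

(* X `&` H spans H, i.e. it is a face of X of codimension one. *)
Definition bounds H X :=
  exists2 s : seq V, (forall x, x \in s -> X x /\ x \in H) & <<s>>%VS = H.

Definition basic A' B H :=
  H \in A' /\ exists B', [/\ is_region A' B', B `<=` B' & bounds H B'].

(* For distinct hyperplanes H1, H2 the subspace H1 :&: H2 has codimension two,
   so the subarrangement below has rank two. *)
Definition basic_digraph A B : rel A := fun H1 H2 : A =>
  (H1 != H2) &&
  `[< basic (subarrangement A (val H1 :&: val H2)) B (val H1) >].

End Arrangements.

Arguments region_le {R n} A B X Y.
Arguments basic_digraph {R n} A B _ _.

Definition induces_acyclic (T : finType) (e : rel T) (I : {set T}) :=
  forall c : seq T, c != [::] -> {subset c <= I} -> ~ ucycle e c.

Definition embeds_in (R : realType) (T : Type) (le : T -> T -> Prop) (d : nat) :=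
  exists2 f : T -> 'rV[R]_d, injective f
    & forall x y, le x y <-> (forall i, f x 0 i <= f y 0 i).

Definition is_order_dimension (R : realType) (T : Type) (le : T -> T -> Prop)
    (d : nat) :=
  embeds_in R le d /\ (forall m, embeds_in R le m -> (d <= m)%N).

(* Main.v *)
From HB Require Import structures.
Require Import Defs.
From mathcomp Require Import all_boot all_order all_algebra finmap.
From mathcomp Require Import all_classical all_reals topology normedtype.
From mathcomp Require Import ring lra zify.

(** A poset embeds in R^k as soon as it carries k monotone real functions such
    that every pair X, Y with X not below Y is told apart by one of them, i.e.
    its value at X exceeds its value at Y.  Here each acyclic set I of the
    covering provides one function: give every hyperplane H of I a positive
    weight exceeding the total weight of the hyperplanes K of I with an edge
    H -> K (possible since I is acyclic, [acyclic_weight]), and let the value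
    at X be the total weight of the hyperplanes of I in S(X).  This is monotone
    in S(X).

    Suppose X is not below Y.  Walk from B to a generic point of X, so that the
    hyperplanes of S(X) are crossed one at a time, and stop at a point z just
    beyond the first crossed hyperplane H of S(X) that is not in S(Y)
    ([first_crossing]).  Then S(z) is contained in S(X), and H is the only
    hyperplane of S(z) outside S(Y).  Now let K be any hyperplane of S(Y) that
    is outside S(z).  The segment from z to the base point b meets H at a point
    p on the side of K that contains b.  Modulo the intersection of H and K we
    are in a plane with basis b, p, so H is the only hyperplane through that
    intersection and p; and one with p on its negative side would also separate
    z, but not Y, from B, so it would be a second hyperplane of S(z) outside
    S(Y).  Hence p is in the relative interior of a facet of the region of the
    rank-two subarrangement around B, i.e. H is basic there and H -> K is an
    edge ([crossing_basic]).  Choosing I in the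
    covering with H in I, the weight of H, which Y misses, exceeds the weight
    of all that Y has and z misses ([weight_sum_lt]), so the value at X, which
    is at least that at z, is larger than the value at Y.

    To run this argument on points, a region is identified with a closed cell:
    the points lying weakly on the same side as a given point x of every
    hyperplane ([region_closed_cell]). *)

Set Implicit Arguments.
Unset Strict Implicit.
Unset Printing Implicit Defensive.
Import Order.TTheory GRing.Theory Num.Theory.
Import numFieldNormedType.Exports.
Local Open Scope classical_set_scope.
Local Open Scope ring_scope.

(** * Weights on acyclic digraphs *)

Section Weights.
Variables (T : finType) (e : rel T) (I : {set T}).

Definition induced : rel T := fun x y => [&& x \in I, y \in I & e x y].

Definition descendants x : {set T} :=
  [set y | [exists z, induced x z && connect induced z y]]%SET.

(** A path from a successor of x back to x, shortened to a simple one, is a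
    directed cycle. *)
Lemma acyclic_not_descendant x :
  induces_acyclic e I -> x \notin descendants x.
Proof.
move=> acI; apply/negP; rewrite inE => /existsP[z].
move=> /andP[xz /connectP[q qP xq]].
move: qP xq xz; case/shortenP => p pP up _ xp xz.
have zpP : cycle induced (z :: p) by rewrite /= rcons_path pP -xp.
apply: (acI (z :: p)) => //.
  move=> u uc; have := next_cycle zpP uc.
  by rewrite /induced => /and3P[].
rewrite /ucycle up andbT.
by apply: sub_cycle zpP => u v /and3P[].
Qed.

(** The number of descendants strictly decreases along edges, so powers
    of a base larger than the number of vertices dominate the sums. *)
Lemma acyclic_weight : induces_acyclic e I ->
  exists W : T -> nat,
    forall x, x \in I -> (\sum_(y in I | e x y) W y < W x)%N.
Proof.
move=> acI; pose h x := #|descendants x|.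
have h_lt x y : induced x y -> (h y < h x)%N.
  move=> xy; apply: proper_card; apply/properP; split.
    apply/fintype.subsetP => u; rewrite !inE => /existsP[z /andP[yz zu]].
    by apply/existsP; exists y; rewrite xy (connect_trans (connect1 yz)).
  exists y; last exact: acyclic_not_descendant.
  by rewrite inE; apply/existsP; exists y; rewrite xy connect0.
exists (fun x => #|T|.+1 ^ h x)%N => x xI.
rewrite -(ltn_pmul2r (ltn0Sn #|T|)) big_distrl /= mulnC.
apply: (@leq_ltn_trans (#|T| * #|T|.+1 ^ h x)); last first.
  by rewrite ltn_pmul2r ?expn_gt0.
rewrite -sum_nat_const big_mkcond /=.
apply: leq_sum => y _; case: ifP => // /andP[yI xy].
by rewrite -expnSr leq_pexp2l //; apply: h_lt; rewrite /induced xI yI.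
Qed.
End Weights.

(** Whatever Y has and Z misses is an out-neighbour of x, hence is outweighed by
    x, which Z has and Y misses. *)
Lemma weight_sum_lt (T : finType) (e : rel T) (I : {set T}) (W : T -> nat)
    (Y Z : pred T) (x : T) :
  x \in I -> Z x -> ~~ Y x ->
  (forall y, y \in I -> Y y -> ~~ Z y -> e x y) ->
  (\sum_(y in I | e x y) W y < W x)%N ->
  (\sum_(y in I | Y y) W y < \sum_(y in I | Z y) W y)%N.
Proof.
move=> xI Zx Yx hY Wx; rewrite [ltnRHS](bigD1 x) /= ?xI //.
apply: (@leq_ltn_trans (\sum_(y in I | e x y) W y +
    \sum_(y in I | Z y && (y != x)) W y)); last first.
  rewrite -addSn leq_add // leq_eqVlt; apply/orP; left; apply/eqP.
  by apply: eq_bigl => y; rewrite andbA.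
rewrite big_mkcond [X in (_ <= X + _)%N]big_mkcond.
rewrite [X in (_ <= _ + X)%N]big_mkcond.
rewrite -big_split; apply: leq_sum => y _ /=.
case: ifP => // /andP[yI Yy]; rewrite yI /=.
have -> : y != x by apply: contraNneq Yx => <-.
case: (boolP (Z y)) => [_|/(hY y yI Yy) ->]; first by rewrite leq_addl.
by rewrite leq_addr.
Qed.

(** * Linear functionals and hyperplanes *)

Section Functionals.
Variables (R : realType) (n : nat).
Local Notation V := 'rV[R]_n.
Implicit Types (f g h : 'Hom(V, R^o)) (H K : {vspace V}).

Lemma hyperplane_sub_eq H K :
  hyperplane H -> hyperplane K -> (H <= K)%VS -> H = K.
Proof.
move=> /eqP hH /eqP hK HK; apply/eqP.
by rewrite eqEdim HK -ltnS hH hK leqnn.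
Qed.

(** The functional is a nonzero coordinate of the projection, along H, onto a
    complementary line. *)
Lemma hyperplane_functional H : hyperplane H ->
  exists f : 'Hom(V, R^o), lker f = H.
Proof.
move=> hH.
have dimC : \dim (H^C)%VS = 1%N.
  by rewrite dimv_compl dimvf /dim /= mul1n; move: (eqP hH); lia.
have [u u0 Cu] : exists2 u, u != 0 & (H^C)%VS = <[u]>%VS.
  exists (vpick (H^C)%VS).
    by rewrite vpick0 -dimv_eq0 dimC.
  apply/eqP; rewrite eq_sym eqEdim dimC dim_vline vpick0 -dimv_eq0 dimC.
  by rewrite -memvE memv_pick.
have [i ui] : exists i, u 0 i != 0.
  by move/rV0Pn: u0.
have cap0 : (H :&: H^C = 0)%VS := capv_compl H.
pose pi := daddv_pi (H^C)%VS H.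
have lin_f : linear (fun x => (pi x) 0 i : R^o).
  by move=> a x y /=; rewrite linearP !mxE.
pose fL := GRing.isLinear.Build R V R^o _ _ lin_f.
pose F : {linear V -> R^o} := HB.pack (fun x => (pi x) 0 i : R^o) fL.
exists (linfun F); apply/vspaceP => x.
rewrite memv_ker lfunE /=.
have xpi : pi x + daddv_pi H (H^C)%VS x = x.
  apply: daddv_pi_add; first by rewrite capvC.
  by rewrite addvC addv_complf memvf.
have : pi x \in (H^C)%VS := memv_pi _ _ _.
rewrite Cu => /vlineP[k kx]; apply/idP/idP => [|xH].
  rewrite kx mxE mulf_eq0 (negPf ui) orbF => /eqP k0.
  by move: xpi; rewrite kx k0 scale0r add0r => <-; exact: memv_pi.
move: xpi; rewrite (daddv_pi_id cap0 xH) => /(canRL (addrK _)).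
by rewrite subrr => ->; rewrite mxE.
Qed.

Lemma hyperplane_functional_pos H b : hyperplane H -> b \notin H ->
  exists2 f : 'Hom(V, R^o), lker f = H & 0 < f b.
Proof.
move=> /hyperplane_functional[f fH]; rewrite -fH memv_ker => fb.
have [f0|f0|/eqP] := ltgtP (f b) 0; last by rewrite (negPf fb).
  exists (- f); last by rewrite opp_lfunE oppr_gt0.
  by apply/vspaceP => x; rewrite !memv_ker opp_lfunE oppr_eq0.
by exists f.
Qed.

Lemma lker_proportional f g : lker f = lker g ->
  exists c : R, forall x, g x = c * f x.
Proof.
move=> fg; have [f0|/lfunPn[u]] := eqVneq f 0.
  exists 0 => x; rewrite mul0r; apply/eqP; rewrite -memv_ker -fg memv_ker f0.
  by rewrite lfunE.
rewrite lfunE /= => fu; exists (g u / f u) => x.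
have : x - (f x / f u) *: u \in lker g.
  by rewrite -fg memv_ker linearB linearZ /= subr_eq0 -[_ *: _]/(_ * _) divfK.
rewrite memv_ker linearB linearZ /= subr_eq0 -[_ *: _]/(_ * _) => /eqP ->.
by rewrite mulrAC [RHS]mulrAC [g u * _]mulrC.
Qed.

Lemma lfunDZ f (x v : V) (a : R) : f (x + a *: v) = f x + a * f v.
Proof. by rewrite linearD linearZ. Qed.

(** Finitely many open conditions survive a small move in the direction v. *)
Lemma small_perturbation (fs : seq 'Hom(V, R^o)) (x v : V) :
  (forall f, f \in fs -> f x != 0) ->
  exists2 e : R, 0 < e & forall a, 0 < a <= e ->
    forall f, f \in fs -> 0 < f x * f (x + a *: v).
Proof.
elim: fs => [|f fs IH] fx; first by exists 1.
have [g gfs|e e0 he] := IH; first by apply: fx; rewrite inE gfs orbT.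
have fx0 : f x != 0 by apply: fx; rewrite inE eqxx.
have d0 : 0 < `|f x| / (1 + `|f v|).
  by rewrite divr_gt0 ?normr_gt0 // ltr_pwDl.
exists (Num.min e (`|f x| / (1 + `|f v|))); first by rewrite lt_min e0.
move=> a /andP[a0]; rewrite le_min => /andP[ae ad] g.
rewrite inE => /predU1P[->|]; last by apply: he; rewrite a0.
move: ad; rewrite ler_pdivlMr ?ltr_pwDl // => ad.
rewrite lfunDZ mulrDr -expr2 -[_ ^+ 2]real_normK ?num_real //.
have : - (`|f x| * (a * `|f v|)) <= f x * (a * f v).
  by rewrite lerNl -{2}(gtr0_norm a0) -!normrM -normrN ler_norm.
have fx1 : 0 < `|f x| by rewrite normr_gt0.
nra.
Qed.

Lemma same_sign_trans (a b c : R) : 0 < a * b -> 0 < b * c -> 0 < a * c.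
Proof.
move=> ab bc; have b0 : 0 < b ^+ 2.
  by rewrite exprn_even_gt0 //=; apply: contraTneq ab => ->; rewrite mulr0 ltxx.
by rewrite -(pmulr_lgt0 _ b0) expr2 mulrACA [c * b]mulrC mulr_gt0.
Qed.

(** Finitely many proper subspaces can be avoided without leaving an open cone:
    each one is left in turn by a move too small to undo what was achieved
    before. *)
Lemma generic_perturbation (fs gs : seq 'Hom(V, R^o)) (x : V) :
  (forall f, f \in fs -> f x != 0) -> (forall g, g \in gs -> g != 0) ->
  exists2 x1 : V, (forall f, f \in fs -> 0 < f x * f x1)
    & forall g, g \in gs -> g x1 != 0.
Proof.
move=> fx; elim: gs => [|g gs IH] gs0.
  by exists x => // f /fx; rewrite -expr2 exprn_even_gt0.
have [h hgs|y fy gy] := IH; first by apply: gs0; rewrite inE hgs orbT.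
have [gy0|gy0] := eqVneq (g y) 0; last first.
  by exists y => // h; rewrite inE => /predU1P[->|/gy].
have /lfunPn[v] : g != 0 by apply: gs0; rewrite inE eqxx.
rewrite lfunE /= => gv.
have [h|e e0 he] := @small_perturbation (fs ++ gs) y v.
  rewrite mem_cat => /orP[/fy|/gy //].
  by apply: contraTneq => ->; rewrite mulr0 ltxx.
exists (y + e *: v) => [f ffs|h].
  apply: same_sign_trans (fy f ffs) (he e _ _ _); first by rewrite e0 lexx.
  by rewrite mem_cat ffs.
rewrite inE => /predU1P[->|hgs].
  by rewrite lfunDZ gy0 add0r mulf_neq0 // gt_eqF.
have : 0 < h y * h (y + e *: v).
  by apply: he; rewrite ?e0 ?lexx ?mem_cat ?hgs ?orbT.
by apply: contraTneq => ->; rewrite mulr0 ltxx.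
Qed.

Lemma functional_continuous f : continuous (f : V -> R^o).
Proof.
have -> : (f : V -> R^o) =
    \sum_(i < n) (fun x : V => x 0 i * f (delta_mx 0 i)).
  apply/funext => x; rewrite fct_sumE {1}[x]row_sum_delta linear_sum.
  by apply: eq_bigr => i _; rewrite linearZ.
elim/big_rec: _ => [|i g _ cg]; first exact: cst_continuous.
move=> x; apply: continuousD; last exact: cg.
by apply: continuousM; [exact: coord_continuous|exact: cst_continuous].
Qed.
End Functionals.

(** * Regions as closed cells *)

Section Regions.
Variables (R : realType) (n : nat).
Local Notation V := 'rV[R]_n.
Implicit Types (A : {fset {vspace V}}) (f g h : 'Hom(V, R^o)).
Implicit Types (H K : {vspace V}).

(** Quantifying over all functionals with kernel in A, rather than choosing one
    for each hyperplane, makes the cells independent of any choice of sides. *)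
Definition open_cell A (x : V) : set V :=
  [set y | forall f : 'Hom(V, R^o), lker f \in A -> 0 < f x * f y].

Definition closed_cell A (x : V) : set V :=
  [set y | forall f : 'Hom(V, R^o), lker f \in A -> 0 <= f x * f y].

Lemma complement_neq0 A x f : complement A x -> lker f \in A -> f x != 0.
Proof. by move=> cx fA; have := cx _ fA; rewrite memv_ker. Qed.

Lemma open_cell_refl A x : complement A x -> open_cell A x x.
Proof.
by move=> cx f fA; rewrite -expr2 exprn_even_gt0 //= (complement_neq0 cx).
Qed.

Lemma scaled_functional_continuous f (c : R) :
  continuous (fun z : V => c * f z : R).
Proof.
have -> : (fun z : V => c * f z) = (c *: f : V -> R^o).
  by apply/funext => z; rewrite scale_lfunE.
exact: functional_continuous.
Qed.

Lemma line_continuous (x v : V) : continuous (fun t : R => x + t *: v).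
Proof.
move=> t; apply: cvgD; first exact: cvg_cst.
exact: scalel_continuous.
Qed.

Lemma closed_cell_sub A (x y : V) :
  open_cell A x y -> closed_cell A x `<=` closed_cell A y.
Proof.
move=> xy z xz f fA; rewrite -(pmulr_rge0 _ (xy f fA)).
have -> : f x * f y * (f y * f z) = f y ^+ 2 * (f x * f z) by ring.
by rewrite mulr_ge0 ?sqr_ge0 // xz.
Qed.

Lemma path_component (S : set V) (x y : V) :
  (forall t : R, 0 <= t <= 1 -> S (x + t *: (y - x))) ->
  connected_component S x y.
Proof.
move=> xyS; pose g := fun t : R => x + t *: (y - x).
have gx : g 0 = x by rewrite /g scale0r addr0.
have gy : g 1 = y by rewrite /g scale1r addrC subrK.
apply: (@connected_component_max _ _ (g @` `[0, 1])).
- by exists 0 => //; rewrite /= in_itv /= lexx ler01.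
- by move=> _ [t + <-]; rewrite /= in_itv /= => /xyS.
- apply: connected_continuous_connected; first exact: segment_connected.
  exact/continuous_subspaceT/line_continuous.
- by exists 1 => //; rewrite /= in_itv /= lexx ler01.
Qed.

(** A cell is convex, so it lies in one component; conversely, by the
    intermediate value theorem a functional that changes sign on a connected
    set vanishes somewhere on it. *)
Lemma component_open_cell A x : (forall H, H \in A -> hyperplane H) ->
  complement A x ->
  connected_component (complement A) x = open_cell A x.
Proof.
move=> hA cx; apply/seteqP; split => [y xy f fA|y xy]; last first.
  apply: path_component => t /andP[t0 t1] H HA.
  have [f fH] := hyperplane_functional (hA _ HA).
  have fA : lker f \in A by rewrite fH.
  rewrite -fH memv_ker; suff : 0 < f x * f (x + t *: (y - x)).
    by apply: contraTneq => ->; rewrite mulr0 ltxx.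
  rewrite lfunDZ linearB /= mulrDr mulrCA mulrBr.
  have := xy _ fA; have := open_cell_refl cx fA.
  move: (f x * f x) (f x * f y) => p q p0 q0.
  have := mulr_ge0 t0 (ltW q0); have := mulr_ge0 (ltW p0) t0.
  case: (ltgtP t 0) t0 t1 => // [t0|->] _ t1; last lra.
  have : 0 < t * q by rewrite mulr_gt0.
  have : 0 <= (1 - t) * p by rewrite mulr_ge0 ?subr_ge0 // ltW.
  nra.
have conn := @component_connected _ (complement A) x.
pose img := (fun z => f x * f z) @` connected_component (complement A) x.
have itv : is_interval img.
  apply/connected_intervalP/connected_continuous_connected => //.
  exact/continuous_subspaceT/scaled_functional_continuous.
rewrite ltNge; apply/negP => fy.
have [] := itv (f x * f y) (f x * f x) _ _ 0.
- by exists y.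
- by exists x => //; exact: connected_component_refl.
- by rewrite fy -expr2 sqr_ge0.
move=> z xz /eqP; rewrite mulf_eq0 (negPf (complement_neq0 cx fA)) /=.
have cz := connected_component_sub xz.
by rewrite (negPf (complement_neq0 cz fA)).
Qed.

(** A point of the closed cell is the limit of points of the segment joining it
    to x, all of which but itself are in the open cell. *)
Lemma region_closed_cell A x : (forall H, H \in A -> hyperplane H) ->
  complement A x ->
  closure (connected_component (complement A) x) = closed_cell A x.
Proof.
move=> hA cx; rewrite component_open_cell //; apply/seteqP; split.
  have -> : closed_cell A x =
      \bigcap_(f in [set f : 'Hom(V, R^o) | lker f \in A])
        ((fun z => f x * f z) @^-1` [set r | 0 <= r]).
    by apply/seteqP; split => y xy f; exact: xy.
  have cl : closed (\bigcap_(f in [set f : 'Hom(V, R^o) | lker f \in A])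
        ((fun z => f x * f z) @^-1` [set r | 0 <= r])).
    apply: closed_bigI => f _; apply: preimage_closed; last exact: closed_ge.
    by move=> z _; exact: scaled_functional_continuous.
  rewrite [X in _ `<=` X](closure_id _).1 //; apply: closureS => y xy f fA /=.
  exact/ltW/xy.
move=> y xy U; pose g := fun t : R => y + t *: (x - y).
have g0 : g 0 = y by rewrite /g scale0r addr0.
have gc : {for 0, continuous g} by exact: line_continuous.
rewrite -{1}g0 => /gc /nbhs_ballP[d /= d0 dU].
have m0 : 0 < Num.min (d / 2) 1 by rewrite lt_min divr_gt0 ?ltr01.
exists (g (Num.min (d / 2) 1)); split; last first.
  apply: dU; rewrite /ball /= sub0r normrN gtr0_norm // gt_min.
  by rewrite ltr_pdivrMr // ltr_pMr // ltr1n.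
move=> f fA; rewrite /g lfunDZ linearB /= mulrDr mulrCA mulrBr.
have := xy _ fA; have := open_cell_refl cx fA.
have : Num.min (d / 2) 1 <= 1 by rewrite ge_min lexx orbT.
move: m0; move: (Num.min _ _) (f x * f x) (f x * f y) => t p q t0 t1 p0 q0.
have : 0 < t * p by rewrite mulr_gt0.
have : 0 <= (1 - t) * q by rewrite mulr_ge0 ?subr_ge0.
nra.
Qed.

Lemma is_regionP A X : (forall H, H \in A -> hyperplane H) ->
  is_region A X -> exists2 x, complement A x & X = closed_cell A x.
Proof.
by move=> hA [x cx ->]; exists x => //; exact: region_closed_cell.
Qed.

(** The functional witnessing separation is a multiple of f, so the sign of
    f b * f x does not depend on it. *)
Lemma separates_closed_cell A x b f : lker f \in A ->
  complement A x -> complement A b ->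
  separates (lker f) (closed_cell A x) (closed_cell A b) <-> f b * f x < 0.
Proof.
move=> fA cx cb; split => [[g [gf gx gb]]|fbx].
  have [c fc] := lker_proportional gf.
  have gx0 := gx x (fun h hA => ltW (open_cell_refl cx hA)).
  have gb0 := gb b (fun h hA => ltW (open_cell_refl cb hA)).
  have fx0 := complement_neq0 cx fA; have fb0 := complement_neq0 cb fA.
  rewrite lt_neqAle mulf_neq0 //= !fc mulrACA mulr_ge0_le0 ?sqr_ge0 //.
  by rewrite mulr_le0_ge0.
exists (- f b *: f); split.
- apply/vspaceP => v; rewrite !memv_ker scale_lfunE /=.
  rewrite -[_ *: _]/(_ * _) mulf_eq0 oppr_eq0.
  by rewrite (negPf (complement_neq0 cb fA)).
- move=> z xz; rewrite scale_lfunE -[_ *: _]/(_ * _).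
  have := xz _ fA; nra.
- move=> z bz; rewrite scale_lfunE -[_ *: _]/(_ * _).
  by have := bz _ fA; rewrite mulNr oppr_le0.
Qed.
End Regions.

(** * Crossing hyperplanes one at a time *)

(** For each hyperplane H of A, F H is an equation of H that is positive on the
    base point b: thus H separates x from the base region when F H x < 0. *)
Section Crossing.
Variables (R : realType) (n : nat) (A : {fset {vspace 'rV[R]_n}}).
Variables (b : 'rV[R]_n) (F : {vspace 'rV[R]_n} -> 'Hom('rV[R]_n, R^o)).
Local Notation V := 'rV[R]_n.
Hypothesis hA : forall H, H \in A -> hyperplane H.
Hypothesis cb : complement A b.
Hypothesis kerF : forall H, H \in A -> lker (F H) = H.
Hypothesis Fb : forall H, H \in A -> 0 < F H b.

Lemma memF K v : K \in A -> (v \in K) = (F K v == 0).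
Proof. by move=> KA; rewrite -{1}(kerF KA) memv_ker. Qed.

(** The hyperplanes H and K are crossed simultaneously on the way from b to z
    exactly when F H z / F H b = F K z / F K b, which confines z to a proper
    subspace; so z can be moved off it. *)
Lemma generic_cone_point (x : V) : complement A x ->
  exists2 z : V, forall H, H \in A -> 0 < F H x * F H z
    & forall H K, H \in A -> K \in A -> H != K ->
        F H z * F K b != F K z * F H b.
Proof.
move=> cx.
(* The equation of the locus where the two hyperplanes are crossed together. *)
pose g (p : {vspace V} * {vspace V}) : 'Hom(V, R^o) :=
  F p.2 b *: F p.1 - F p.1 b *: F p.2.
have gE p v : g p v = F p.2 b * F p.1 v - F p.1 b * F p.2 v.
  by rewrite /g add_lfunE opp_lfunE !scale_lfunE.
pose hyps := enum_fset A.
pose gs := [seq g p | p <- [seq (H, K) | H <- hyps, K <- hyps] & p.1 != p.2].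
have [f|h|z fz gz] := @generic_perturbation R n [seq F H | H <- hyps] gs x.
- move=> /mapP[H HA ->]; apply: (complement_neq0 cx).
  by rewrite kerF.
- move=> /mapP[p +  ->]; rewrite mem_filter.
  move=> /andP[+ /allpairsP[[H K] /= [HA KA pE]]].
  move=> HK; rewrite pE; apply: contra_neq HK => g0.
  have sub : (H <= K)%VS.
    apply/subvP => v; rewrite !memF // => /eqP Hv.
    have := gE (H, K) v; rewrite g0 lfunE /= Hv mulr0 sub0r => /esym /eqP.
    by rewrite oppr_eq0 mulf_eq0 (gt_eqF (Fb HA)).
  by rewrite pE; exact: hyperplane_sub_eq (hA HA) (hA KA) sub.
exists z => [H HA|H K HA KA HK]; first by apply: fz; apply: map_f.
have : g (H, K) z != 0.
  apply/gz/map_f; rewrite mem_filter HK; exact: allpairs_f.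
by rewrite gE /= subr_eq0 mulrC [F H b * _]mulrC.
Qed.

(** On the half-line w + s b, s >= 0, with w generic in the cell of x, the
    hyperplane K is crossed at s = - F K w / F K b.  Among the hyperplanes that
    separate x but not y from b, let H be the one crossed last as s grows, i.e.
    first when coming from b; z is a point where only H is left to cross. *)
Lemma first_crossing (x y : V) (H0 : {vspace V}) : complement A x ->
  H0 \in A -> F H0 x < 0 -> 0 < F H0 y ->
  exists (z : V) (H : {vspace V}),
    [/\ H \in A, F H z < 0, 0 < F H y,
        forall K, K \in A -> F K z < 0 -> F K x < 0
      & forall K, K \in A -> F K z < 0 -> 0 < F K y -> K = H].
Proof.
move=> cx H0A H0x H0y.
have [w wx wne] := generic_cone_point cx.
pose r (K : A) := F (val K) w / F (val K) b.
pose D := [pred K : A | (F (val K) x < 0) && (0 < F (val K) y)].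
have D0 : D [` H0A]%fset by rewrite /D /= H0x.
case: (Order.TotalTheory.arg_minP r D0) => H /andP[Hx Hy] Hmin.
(* The parameter at which the last hyperplane of D other than H is crossed, or
   0 if there is none; z itself may lie on that hyperplane. *)
pose s := \big[Order.max/0]_(K | D K && (K != H)) (- r K).
have FE (K : A) : F (val K) (w + s *: b) = F (val K) b * (r K + s).
  rewrite lfunDZ mulrDr /r mulrCA divff ?mulr1 ?[F _ b * _]mulrC //.
  by rewrite gt_eqF // Fb //; exact: valP.
have Fb' (K : A) : 0 < F (val K) b by apply: Fb; exact: valP.
have s0 : 0 <= s by apply: bigmax_ge_id.
have neg (K : A) : F (val K) (w + s *: b) < 0 -> F (val K) x < 0.
  rewrite lfunDZ => Kz; have Kw : F (val K) w < 0.
    by apply: le_lt_trans Kz; rewrite lerDl mulr_ge0 // ltW.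
  by have := wx _ (valP K); rewrite nmulr_lgt0.
have rne (K : A) : K != H -> r K != r H.
  move=> KH; apply/eqP => rKH.
  have wE (L : A) : F (val L) w = r L * F (val L) b.
    by rewrite /r divfK // gt_eqF.
  have KH' : val K != val H by rewrite val_eqE.
  have := wne (val K) (val H) (valP K) (valP H) KH'.
  by rewrite !wE rKH mulrAC eqxx.
have sH : s < - r H.
  apply: bigmax_lt => [|K /andP[KD KH]].
    rewrite oppr_gt0 /r pmulr_llt0 ?invr_gt0 //.
    by have := wx _ (valP H); rewrite nmulr_rgt0.
  by rewrite ltrN2 lt_neqAle eq_sym rne // Hmin.
exists (w + s *: b), (val H); split => //.
- exact: valP.
- by rewrite FE pmulr_rlt0 // addrC -ltrBrDr sub0r.
- by move=> K KA; exact: (neg [` KA]%fset).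
- move=> K KA Kz Ky; apply/eqP/negPn/negP => KH.
  have KD : D [` KA]%fset by rewrite /D /= Ky andbT; exact: (neg [` KA]%fset).
  have : - r [` KA]%fset <= s.
    by apply: le_bigmax_cond; rewrite KD.
  move: Kz; rewrite (FE [` KA]%fset) pmulr_rlt0 ?Fb //.
  by rewrite lerNl leNgt -ltrBrDr sub0r => ->.
Qed.

(** The point where the segment from z to b meets H is strictly on the positive
    side of every other hyperplane through the intersection of H and H': such a
    hyperplane with that point on its negative side would separate z but not y
    from b.  The inequality at z for H' is weak because the point given by
    [first_crossing] may lie on hyperplanes of A. *)
Lemma crossing_basic (B : set V) (y z : V) (H H' : {vspace V}) :
  B = closed_cell A b -> H \in A -> H' \in A ->
  F H z < 0 -> 0 < F H y -> 0 <= F H' z -> F H' y < 0 ->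
  (forall K, K \in A -> F K z < 0 -> 0 < F K y -> K = H) ->
  basic (subarrangement A (H :&: H')%VS) B H.
Proof.
move=> BE HA H'A Hz Hy H'z H'y uniq.
set A' := subarrangement _ _.
have A'P K : (K \in A') = (K \in A) && (H :&: H' <= K)%VS.
  by rewrite /A' /subarrangement !inE.
have A'A K : K \in A' -> K \in A by rewrite A'P => /andP[].
have HA' : H \in A' by rewrite A'P HA capvSl.
split=> //; exists (closed_cell A' b).
have cb' : complement A' b by move=> K /A'A; exact: cb.
have hA' K : K \in A' -> hyperplane K by move=> /A'A; exact: hA.
split.
- by exists b => //; rewrite region_closed_cell.
- by rewrite BE => v vB f /A'A; exact: vB.
(* Up to a positive factor, p is the point where the segment from z to b
   meets H. *)
pose p := F H b *: z - F H z *: b.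
have Fp K : F K p = F H b * F K z - F H z * F K b.
  by rewrite /p linearB !linearZ.
have FHb := Fb HA; have FH'b := Fb H'A.
have Hp : F H p = 0 by rewrite Fp; ring.
have H'p : 0 < F H' p.
  rewrite Fp subr_gt0 (@lt_le_trans _ _ 0) ?nmulr_rlt0 //.
  by rewrite mulr_ge0 // ltW.
have inL v : F H v = 0 -> F H' v = 0 -> v \in (H :&: H')%VS.
  by move=> Hv H'v; rewrite memv_cap !memF // Hv H'v eqxx.
have FL K v c d : F K (v - (c *: b + d *: p)) = F K v - (c * F K b + d * F K p).
  by rewrite linearB linearD !linearZ.
(* Modulo the intersection of H and H', the vectors b and p form a basis. *)
have decomp K v : K \in A' ->
    F K v = F H v / F H b * F K b
            + (F H' v - F H v / F H b * F H' b) / F H' p * F K p.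
  rewrite A'P => /andP[KA sub]; apply/eqP; rewrite -subr_eq0 -FL -memF //.
  apply: (subvP sub); apply: inL; rewrite FL.
    by rewrite Hp mulr0 addr0 divfK ?subrr // gt_eqF.
  by rewrite divfK ?gt_eqF //; ring.
(* Were F K p negative, decomp would give 0 < F K y, as y is on the positive
   side of H and the negative side of H'; then K would contradict uniq. *)
have pos K : K \in A' -> K != H -> 0 < F K p.
  move=> KA' KH; have KA := A'A _ KA'; have FKb := Fb KA.
  have [Kp|//|Kp] := ltgtP (F K p) 0.
    case/eqP: KH; apply: uniq => //.
      rewrite -(pmulr_rlt0 _ FHb); apply: (@lt_trans _ _ (F H z * F K b)).
        by rewrite -subr_lt0 -Fp.
      by rewrite nmulr_rlt0.
    rewrite (decomp _ y KA').
    have c0 : 0 < F H y / F H b by rewrite divr_gt0.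
    apply: addr_gt0; first exact: mulr_gt0.
    rewrite nmulr_lgt0 // pmulr_llt0 ?invr_gt0 //.
    by rewrite subr_lt0 (lt_trans H'y) // mulr_gt0.
  case/eqP: KH; apply/esym/(hyperplane_sub_eq (hA HA) (hA KA)).
    apply/subvP => v; rewrite !memF // => /eqP Hv.
    rewrite (decomp _ v KA') Kp Hv.
    by rewrite !mul0r mulr0 addr0.
(* Since p is off all other hyperplanes of A', a neighbourhood of p in H lies
   in the region around b, and p with small translates along a basis of H
   spans H. *)
have e_ex (v : V) : exists e : R,
    0 < e /\ (v \in H -> closed_cell A' b (p + e *: v)).
  pose fs := [seq F K | K <- enum_fset A' & K != H].
  have [f /mapP[K]|e e0 he] := @small_perturbation R n fs p v.
    by rewrite mem_filter => /andP[KH KA'] ->; rewrite gt_eqF // pos.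
  exists e; split=> // vH f fA'.
  have [c fc] : exists c, forall u, f u = c * F (lker f) u.
    by apply: lker_proportional; rewrite kerF // A'A.
  rewrite !fc mulrACA -expr2 mulr_ge0 ?sqr_ge0 //.
  have [fH|fH] := eqVneq (lker f) H.
    rewrite fH lfunDZ Hp add0r; move: vH; rewrite memF // => /eqP->.
    by rewrite !mulr0.
  rewrite mulr_ge0 ?(ltW (Fb _)) ?A'A //.
  have : 0 < F (lker f) p * F (lker f) (p + e *: v).
    apply: he; rewrite ?e0 ?lexx //; apply: map_f.
    by rewrite mem_filter fH; exact: fA'.
  by rewrite pmulr_rgt0 ?pos // => /ltW.
have [e he] := choice e_ex.
have pH : p \in H by rewrite memF // Hp.
pose s := p :: [seq p + e v *: v | v <- vbasis H].
have sH x : x \in s -> x \in H.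
  rewrite inE => /predU1P[->//|/mapP[v vb ->]].
  by rewrite memvD // memvZ // vbasis_mem.
exists s => [x xs|].
  split; last exact: sH.
  move: xs; rewrite inE => /predU1P[->|/mapP[v vb ->]].
    have [_] := he 0; rewrite scaler0 addr0; apply; exact: mem0v.
  by have [_] := he v; apply; exact: vbasis_mem.
apply/eqP; rewrite eqEsubv; apply/andP; split; first by apply/span_subvP.
rewrite -(span_basis (vbasisP H)); apply/span_subvP => v vb.
have [ev _] := he v.
have -> : v = (e v)^-1 *: ((p + e v *: v) - p).
  by rewrite addrC addKr scalerA mulVf ?scale1r // gt_eqF.
rewrite memvZ // memvB // memv_span // inE ?eqxx //.
by apply/orP; right; apply/mapP; exists v.
Qed.
End Crossing.

(** * Order dimension *)

Lemma order_dimension_le (R : realType) (T : Type) (le : T -> T -> Prop)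
    (k : nat) :
  embeds_in R le k -> exists2 d, is_order_dimension R le d & (d <= k)%N.
Proof.
move=> emb; have ex : exists d, `[< embeds_in R le d >].
  by exists k; apply/asboolP.
case: (ex_minnP ex) => d /asboolP demb dmin; exists d.
  by split=> // m memb; apply: dmin; apply/asboolP.
by apply: dmin; apply/asboolP.
Qed.

Section Dimension.
Variables (R : realType) (n : nat) (A : {fset {vspace 'rV[R]_n}}).
Variable B : set 'rV[R]_n.
Local Notation V := 'rV[R]_n.
Hypothesis hA : is_arrangement A.
Hypothesis hB : is_region A B.

(** The coordinate attached to I in P is the total weight of the hyperplanes of
    I that separate a region from B. *)
Theorem acyclic_cover_embeds (P : {set {set A}}) :
  finset.cover P = [set: A]%SET ->
  (forall I, I \in P -> induces_acyclic (basic_digraph A B) I) ->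
  embeds_in R (region_le A B) #|P|.
Proof.
move=> coverP acP.
have hyp H : H \in A -> hyperplane H by case: hA => _; exact.
have [b cb BE] := is_regionP hyp hB.
have F_ex (H : {vspace V}) : exists f : 'Hom(V, R^o),
    H \in A -> lker f = H /\ 0 < f b.
  have [HA|_] := boolP (H \in A); last by exists 0.
  by have [f] := hyperplane_functional_pos (hyp _ HA) (cb _ HA); exists f.
have [F hF] := choice F_ex.
have kerF H : H \in A -> lker (F H) = H by move=> /hF[].
have Fb H : H \in A -> 0 < F H b by move=> /hF[].
have sepE x H : complement A x -> H \in A ->
    separates H (closed_cell A x) B <-> F H x < 0.
  move=> cx HA; rewrite BE -{1}(kerF _ HA) separates_closed_cell ?kerF //.
  by rewrite pmulr_rlt0 // Fb.
have regP (X : region A) : exists2 x, complement A x & sval X = closed_cell A x.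
  exact: is_regionP hyp (svalP X).
have sval_inj (X Y : region A) : sval X = sval Y -> X = Y.
  by case: X Y => [X pX] [Y pY] /= XY; exact: eq_exist.
have W_ex (I : {set A}) : exists W : A -> nat, I \in P ->
    forall H, H \in I -> (\sum_(K in I | basic_digraph A B H K) W K < W H)%N.
  have [IP|_] := boolP (I \in P); last by exists (fun=> 0%N).
  by have [W hW] := acyclic_weight (acP I IP); exists W.
have [W hW] := choice W_ex.
pose val_pt (I : {set A}) (x : V) :=
  (\sum_(H in I | (F (val H) x < 0)%R) W I H)%N.
pose value (I : {set A}) (X : region A) :=
  (\sum_(H in I | `[< separates (val H) (sval X) B >]) W I H)%N.
have valueE I X x : complement A x -> sval X = closed_cell A x ->
    value I X = val_pt I x.
  move=> cx Xx; apply: eq_bigl => H; congr (_ && _).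
  rewrite Xx; apply/asboolP/idP => /sepE; apply => //; exact: valP.
have val_mono I x z : (forall H, H \in A -> F H z < 0 -> F H x < 0) ->
    (val_pt I z <= val_pt I x)%N.
  move=> zx; rewrite /val_pt big_mkcond [leqRHS]big_mkcond /=.
  apply: leq_sum => H _; case: ifP => // /andP[-> Hz].
  by rewrite zx //; exact: valP.
have le_pt X Y x y : complement A x -> complement A y ->
    sval X = closed_cell A x -> sval Y = closed_cell A y ->
    region_le A B X Y <-> (forall H, H \in A -> F H x < 0 -> F H y < 0).
  move=> cx cy Xx Yy; rewrite /region_le Xx Yy; split.
    move=> XY H HA Hx; have [|_] := XY H; last by move/(sepE _ _ cy HA).
    by split=> //; apply/sepE.
  move=> xy H [HA /(sepE _ _ cx HA) Hx]; split=> //.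
  by apply/(sepE _ _ cy HA); exact: xy.
have le_val X Y : region_le A B X Y <->
    forall i : 'I_#|P|, (value (enum_val i) X <= value (enum_val i) Y)%N.
  have [x cx Xx] := regP X; have [y cy Yy] := regP Y.
  split=> [/(le_pt _ _ _ _ cx cy Xx Yy) XY i|XY].
    by rewrite (valueE _ _ _ cx Xx) (valueE _ _ _ cy Yy) val_mono.
  apply/(le_pt _ _ _ _ cx cy Xx Yy) => H0 H0A H0x.
  have [//|H0y|H0y] := ltgtP (F H0 y) 0; last first.
    by have := cy _ H0A; rewrite (memF kerF) // H0y eqxx.
  (* X is not below Y: the coordinate of a member of P containing the crossed
     hyperplane is larger at X than at Y. *)
  have [z [H [HA Hz Hy zx uniq]]] := first_crossing hyp kerF Fb cx H0A H0x H0y.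
  have : [` HA]%fset \in finset.cover P by rewrite coverP inE.
  move=> /bigcupP[I IP HI].
  have := XY (enum_rank_in IP I); rewrite enum_rankK_in //.
  rewrite (valueE _ _ _ cx Xx) (valueE _ _ _ cy Yy).
  have := val_mono I x z zx => zx' xy'; have := leq_trans zx' xy'.
  rewrite leqNgt => /negP[].
  apply: (weight_sum_lt (e := basic_digraph A B) HI) => //=.
  - by rewrite -leNgt ltW.
  - move=> K KI Ky; rewrite -leNgt => Kz.
    have KA := valP K.
    rewrite /basic_digraph; apply/andP; split.
      by apply: contraTneq Kz => <-; rewrite -ltNge.
    apply/asboolP; exact: (crossing_basic hyp cb kerF Fb BE HA KA Hz Hy Kz Ky).
  - exact: hW.
exists (fun X => \row_i (value (enum_val i) X)%:R) => [X Y /rowP XY|X Y].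
  have [x cx Xx] := regP X; have [y cy Yy] := regP Y.
  have vXY (i : 'I_#|P|) : value (enum_val i) X = value (enum_val i) Y.
    by have /eqP := XY i; rewrite !mxE eqr_nat => /eqP.
  have /(le_pt _ _ _ _ cx cy Xx Yy) xy : region_le A B X Y.
    by apply/le_val => i; rewrite vXY.
  have /(le_pt _ _ _ _ cy cx Yy Xx) yx : region_le A B Y X.
    by apply/le_val => i; rewrite vXY.
  have xyF H : H \in A -> 0 < F H x * F H y.
    move=> HA; have [Hx|Hx|Hx] := ltgtP (F H x) 0.
    - by rewrite nmulr_rgt0 // xy.
    - rewrite pmulr_rgt0 // lt_neqAle leNgt eq_sym; apply/andP; split.
        by rewrite -(memF kerF) // cy.
      by apply/negP => /(yx _ HA); rewrite ltNge ltW.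
    - by have := cx _ HA; rewrite (memF kerF) // Hx eqxx.
  have xyo : open_cell A x y.
    move=> f fA; have [c fc] := lker_proportional (kerF _ fA).
    rewrite !fc mulrACA mulr_gt0 ?xyF // -expr2 exprn_even_gt0 //=.
    by apply: contraTneq (cx _ fA) => c0; rewrite memv_ker fc c0 mul0r eqxx.
  apply: sval_inj; rewrite Xx Yy; apply/seteqP; split.
    exact: closed_cell_sub.
  by apply: closed_cell_sub => f fA; rewrite mulrC; exact: xyo.
rewrite le_val; split=> [XY i|XY i]; first by rewrite !mxE ler_nat.
by have := XY i; rewrite !mxE ler_nat.
Qed.
End Dimension.

Theorem theorem1p2 (R : realType) (n : nat) (A : {fset {vspace 'rV[R]_n}})
    (B : set 'rV[R]_n) (hA : is_arrangement A) (hB : is_region A B) :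
  (forall P : {set {set A}},
     finset.partition P [set: A]%SET ->
     (forall I, I \in P -> induces_acyclic (basic_digraph A B) I) ->
     exists2 d, is_order_dimension R (region_le A B) d & (d <= #|P|)%N) /\
  (forall P : {set {set A}},
     finset.cover P = [set: A]%SET ->
     (forall I, I \in P -> induces_acyclic (basic_digraph A B) I) ->
     exists2 d, is_order_dimension R (region_le A B) d & (d <= #|P|)%N).
Proof.
split=> P hP acP; apply: order_dimension_le; apply: acyclic_cover_embeds => //.
exact: cover_partition.
Qed.
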